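(* For an arbitrary convex configuration $V$ (with parameters $n$, $(a_i)$, $(b_i)$) and integer tuples $\lambda=(\lambda_{a_n+1},\ldots,\lambda_{b_n})$, $\bar\lambda=(\bar\lambda_1,\ldots,\bar\lambda_{b_0})$, $\mu=(\mu_1,\ldots,\mu_n)$, the polyhedron $\mathcal{SC}(\lambda\setminus\bar\lambda,\mu)\subset\mathbb R^V$ is integral, i.e., each (nonempty) face of this polyhedron contains an integer point.
   Context: Convex configuration. Let $n\ge 1$ and let $a_0,\ldots,a_n,b_0,\ldots,b_n$ be integers with $a_i\le b_i$ for all $i$, $a_0=0$, $0\le a_1-a_0\le a_2-a_1\le\cdots\le a_n-a_{n-1}\le 1$ and $1\ge b_1-b_0\ge b_2-b_1\ge\cdots\ge b_n-b_{n-1}\ge 0$. The corresponding convex configuration is $V=\{(i,j)\in\mathbb Z^2:0\le i\le n,\ a_i\le j\le b_i\}$; arrays are elements $X=(x_{ij})_{(i,j)\in V}$ of $\mathbb R^V$. The row derivative is $\partial x_{ij}:=x_{ij}-x_{i,j-1}$ for $0\le i\le n$, $a_i+1\le j\le b_i$. The array $X$ is strip-concave if for all $i=1,\ldots,n$ and all $j$: $\partial x_{ij}\ge \partial x_{i-1,j}$ whenever both sides are defined, and $\partial x_{i-1,j}\ge\partial x_{i,j+1}$ whenever both sides are defined. $\mathcal{SC}_V$ denotes the set of strip-concave $X\in\mathbb R^V$ with $x_{00}=0$. Boundary tuples: $\lambda^X_j:=\partial x_{nj}$ ($j=a_n+1,\ldots,b_n$), $\bar\lambda^X_j:=\partial x_{0j}$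 ($j=1,\ldots,b_0$), $\mu^X_i:=x_{ia_i}-x_{i-1,a_{i-1}}$ ($i=1,\ldots,n$). $\mathcal{SC}(\lambda\setminus\bar\lambda,\mu):=\{X\in\mathcal{SC}_V:(\lambda^X,\bar\lambda^X,\mu^X)=(\lambda,\bar\lambda,\mu)\}$ (the right boundary is not prescribed). An integer point is an array with all entries integer. *)

(* Defs.v *)
From mathcomp Require Import all_boot all_order all_algebra.
From mathcomp Require Import finmap.
From mathcomp Require Import archimedean classical_sets reals.

Set Implicit Arguments.
Unset Strict Implicit.
Unset Printing Implicit Defensive.

Import Order.TTheory GRing.Theory Num.Theory.

Local Open Scope ring_scope.

(* Tuples are total functions; only the values at the indices of the tuple
   (here 0, ..., n) are ever used. *)
Record convex_params (n : nat) (a b : nat -> int) : Prop := ConvexParams {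
  cp_n_ge1 : (1 <= n)%N;
  cp_a0 : a 0%N = 0;
  cp_le : forall i, (i <= n)%N -> a i <= b i;
  cp_a_first : 0 <= a 1%N - a 0%N;
  cp_a_convex : forall i, (i.+2 <= n)%N -> a i.+1 - a i <= a i.+2 - a i.+1;
  cp_a_last : a n - a n.-1 <= 1;
  cp_b_first : b 1%N - b 0%N <= 1;
  cp_b_concave : forall i, (i.+2 <= n)%N -> b i.+2 - b i.+1 <= b i.+1 - b i;
  cp_b_last : 0 <= b n - b n.-1
}.

(* Given as an explicit finite enumeration, valid when a i <= b i for i <= n;
   [mem_configuration] is the expected description. *)
Definition configuration (n : nat) (a b : nat -> int) : {fset nat * int} :=
  [fset (i, (a i + k%:Z)%R) | i in iota 0 n.+1, k in iota 0 (`|b i - a i|%N).+1]%fset.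

Lemma mem_configuration n a b i j : convex_params n a b ->
  ((i, j) \in configuration n a b) = (i <= n)%N && (a i <= j <= b i).
Proof.
move=> cp; apply/imfset2P/andP => /=.
  case=> i'; rewrite -[i' \in _]/(i' \in iota 0 n.+1) mem_iota add0n ltnS
    => /= i'n [k].
  rewrite -[k \in _]/(k \in iota 0 (`|b i' - a i'|%N).+1) mem_iota.
  rewrite add0n ltnS => /= kle [-> ->].
  have ab := cp_le cp i'n; split=> //.
  by rewrite lerDl lez_nat leq0n /= -lerBrDl -[b i' - a i']gez0_abs ?subr_ge0.
case=> ile /andP[aj jb]; exists i.
  by rewrite -[i \in _]/(i \in iota 0 n.+1) mem_iota.
have ab := cp_le cp ile; exists `|j - a i|%N.
  rewrite -[_ \in _]/(`|j - a i|%N \in iota 0 (`|b i - a i|%N).+1) mem_iota.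
  by rewrite add0n ltnS leq0n /= -lez_nat !gez0_abs ?subr_ge0 // lerD2r.
by rewrite gez0_abs ?subr_ge0 // subrKC.
Qed.

Section Arrays.
Variables (R : realType) (n : nat) (a b : nat -> int).

Definition array : Type := {ffun configuration n a b -> R}.

(* x_ij, with the junk value 0 when (i, j) is outside the configuration *)
Definition entry (X : array) (i : nat) (j : int) : R :=
  if insub (i, j) is Some v then X v else 0.

Definition row_deriv (X : array) (i : nat) (j : int) : R :=
  entry X i j - entry X i (j - 1).

Definition row_deriv_defined (i : nat) (j : int) : bool :=
  (i <= n)%N && (a i + 1 <= j <= b i).

Definition strip_concave (X : array) : Prop :=
  forall (i : nat) (j : int), (1 <= i <= n)%N ->
    (row_deriv_defined i j -> row_deriv_defined i.-1 j ->
       row_deriv X i.-1 j <= row_deriv X i j) /\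
    (row_deriv_defined i.-1 j -> row_deriv_defined i (j + 1) ->
       row_deriv X i (j + 1) <= row_deriv X i.-1 j).

Definition SC : set array :=
  [set X | strip_concave X /\ entry X 0%N 0 = 0]%classic.

Definition SC_boundary (lam lambar : int -> R) (mu : nat -> R) : set array :=
  [set X | [/\ SC X,
    forall j : int, a n + 1 <= j <= b n -> row_deriv X n j = lam j,
    forall j : int, 1 <= j <= b 0%N -> row_deriv X 0%N j = lambar j &
    forall i : nat, (1 <= i <= n)%N ->
      entry X i (a i) - entry X i.-1 (a i.-1) = mu i]]%classic.

End Arrays.

Arguments SC_boundary {R} n a b lam lambar mu _.

Section Faces.
Variables (R : realType) (V : finType).
Implicit Types (P F : set {ffun V -> R}) (x : {ffun V -> R}).

(* Intersections of P with a hyperplane bounding a half-space that contains P.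
   The zero functional is allowed, so P and the empty set are faces too. *)
Definition is_face P F : Prop :=
  exists (c : {ffun V -> R}) (d : R),
    (forall x, P x -> \sum_v c v * x v <= d) /\
    F = [set x | P x /\ \sum_v c v * x v = d]%classic.

Definition integer_point x : Prop := forall v, x v \is a Num.int.

Definition integral_polyhedron P : Prop :=
  forall F, is_face P F -> (F !=set0)%classic ->
    exists2 x, F x & integer_point x.

End Faces.

(* Main.v *)
Require Import Defs.
From mathcomp Require Import all_boot all_order all_algebra.
From mathcomp Require Import finmap.
From mathcomp Require Import archimedean classical_sets reals.
From mathcomp Require Import zify ring lra.

(** The prescribed left boundary is integral, so an array is determined by its
    row derivatives, and it is integral as soon as they are.  In terms of the row
    derivatives, the polyhedron is cut out by inequalities comparing two of
    them and by equations giving some of them integer values.  Hence a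
    function [g] that preserves the order between the row derivatives of a
    point [X] and fixes the integers, applied to each row derivative, gives
    another point of the polyhedron ([SC_boundary_map_derivs]).

    Taking for [g] the floor function gives an integer point [Z].  It lies on
    every face through [X]: rounding down sends equal row derivatives to equal
    ones, so every constraint tight at [X] is tight at [Z], and the segment
    from [Z] to [X] can be prolonged a little beyond [X] inside the
    polyhedron.  The prolonged point is obtained with
    [g t = t + e * (t - floor t)], which preserves the order of the finitely
    many row derivatives of [X] when [e] is at most the smallest gap between
    two distinct values among them ([exists_le_pos_gaps]).  A linear functional that attains its maximum at an
    inner point of a segment is constant on it ([face_prolongation]), so [Z] is
    on the face. *)

Set Implicit Arguments.
Unset Strict Implicit.
Unset Printing Implicit Defensive.

Import Order.TTheory GRing.Theory Num.Theory.

Local Open Scope ring_scope.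

(** The point [x] is a convex combination of [z] and the prolonged point with
    positive weights; a functional bounded by [d] at both and equal to [d] at
    [x] equals [d] at both. *)
Lemma face_prolongation (R : realType) (V : finType)
    (P F : set {ffun V -> R}) (x z : {ffun V -> R}) (e : R) :
  is_face P F -> F x -> P z -> 0 < e ->
  P [ffun v => x v + e * (x v - z v)] -> F z.
Proof.
move=> [c [d [cP ->]]] [_ cx] Pz e0 /cP cw; split=> //.
apply/eqP; rewrite eq_le cP //=.
have : \sum_v c v * [ffun v => x v + e * (x v - z v)] v
       = d + e * (d - \sum_v c v * z v).
  rewrite -{1 2}cx -sumrB mulr_sumr -big_split /=.
  by apply: eq_bigr => v _; rewrite ffunE; ring.
move=> cwE; move: cw; rewrite cwE gerDl pmulr_rle0 //.
by rewrite subr_le0.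
Qed.

Lemma exists_le_pos_gaps (R : realType) (I : finType) (y : I -> R) :
  exists2 e : R, 0 < e & forall i j, y i < y j -> e <= y j - y i.
Proof.
exists (\big[Order.min/1]_(p : I * I | y p.1 < y p.2) (y p.2 - y p.1)).
  by apply: (big_ind (fun s => 0 < s)) => // [s t s0 t0|p]; rewrite ?lt_min ?s0 // subr_gt0.
move=> i j yij.
exact: (bigmin_le_cond (j := (i, j)) (P := fun p => y p.1 < y p.2)
  1 (fun p => y p.2 - y p.1)).
Qed.

Section MapDerivs.
Variables (R : realType) (n : nat) (a b : nat -> int).
Hypothesis hV : convex_params n a b.
Implicit Types (X : array R n a b) (g : R -> R).

(** The array with the left boundary of [X] whose row derivatives are the
    images under [g] of those of [X]. *)
Definition map_derivs g X : array R n a b :=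
  [ffun v => entry X (val v).1 (a (val v).1) +
     \sum_(k < `|(val v).2 - a (val v).1|%N)
        g (row_deriv X (val v).1 (a (val v).1 + k.+1%:Z))].

Lemma row_deriv_defined_mem i j :
  row_deriv_defined n a b i j -> (i, j) \in configuration n a b.
Proof.
move=> /and3P[ile aj jb]; rewrite mem_configuration // ile jb andbT.
by apply: le_trans aj; rewrite lerDl.
Qed.

Lemma entry_val X (v : configuration n a b) :
  X v = entry X (val v).1 (val v).2.
Proof. by rewrite /entry -surjective_pairing valK. Qed.

Lemma entry_map_derivs g X i (k : nat) : (i <= n)%N -> a i + k%:Z <= b i ->
  entry (map_derivs g X) i (a i + k%:Z) =
  entry X i (a i) + \sum_(l < k) g (row_deriv X i (a i + l.+1%:Z)).
Proof.
move=> ile kb.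
have m : (i, a i + k%:Z) \in configuration n a b.
  by rewrite mem_configuration // ile kb lerDl.
rewrite /entry (insubT (fun v => v \in configuration n a b) m) ffunE /=.
by rewrite addrAC subrr add0r absz_nat.
Qed.

Lemma entry_map_derivs_left g X i : (i <= n)%N ->
  entry (map_derivs g X) i (a i) = entry X i (a i).
Proof.
move=> ile; have := @entry_map_derivs g X i 0%N ile.
by rewrite addr0 big_ord0 addr0; apply; apply: cp_le hV _ ile.
Qed.

Lemma row_deriv_map_derivs g X i j : row_deriv_defined n a b i j ->
  row_deriv (map_derivs g X) i j = g (row_deriv X i j).
Proof.
move=> /and3P[ile aj jb].
have [k jE] : exists k : nat, j = a i + k.+1%:Z.
  by exists `|(j - a i - 1)%R|%N; lia.
rewrite {1}/row_deriv jE.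
have -> : a i + k.+1%:Z - 1 = a i + k%:Z by lia.
rewrite !entry_map_derivs //; [|lia..].
by rewrite big_ord_recr /=; ring.
Qed.

Lemma sum_row_deriv X i (k : nat) :
  \sum_(l < k) row_deriv X i (a i + l.+1%:Z) =
  entry X i (a i + k%:Z) - entry X i (a i).
Proof.
elim: k => [|k IHk]; first by rewrite big_ord0 addr0 subrr.
rewrite big_ord_recr /= IHk /row_deriv.
have -> : a i + k.+1%:Z - 1 = a i + k%:Z by lia.
by ring.
Qed.

(** The prolongation beyond [X] of the segment from [map_derivs g X] to [X]
    is itself of the form [map_derivs], because [map_derivs] is affine in [g]
    and sends the identity to [X]. *)
Lemma map_derivs_prolongation g (e : R) X :
  map_derivs (fun t => t + e * (t - g t)) X =
  [ffun v => X v + e * (X v - map_derivs g X v)].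
Proof.
apply/ffunP => v; rewrite !ffunE entry_val.
have := valP v; case: (val v) => i j /=; rewrite mem_configuration //.
move=> /and3P[ile aj jb].
rewrite big_split /= sum_row_deriv -mulr_sumr sumrB sum_row_deriv.
have -> : a i + `|j - a i|%N%:Z = j by lia.
by ring.
Qed.

Lemma SC_boundary_map_derivs (lam lambar : int -> int) (mu : nat -> R) g X :
  SC_boundary n a b (fun j => (lam j)%:~R) (fun j => (lambar j)%:~R) mu X ->
  (forall m : int, g m%:~R = m%:~R) ->
  (forall i j k l, row_deriv_defined n a b i j -> row_deriv_defined n a b k l ->
     row_deriv X i j <= row_deriv X k l ->
     g (row_deriv X i j) <= g (row_deriv X k l)) ->
  SC_boundary n a b (fun j => (lam j)%:~R) (fun j => (lambar j)%:~R) mu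
    (map_derivs g X).
Proof.
move=> [[Xsc X00] Xlam Xlambar Xmu] gint gmono; split.
- split.
    move=> i j hi; have [c1 c2] := Xsc i j hi.
    by split=> d1 d2; rewrite !row_deriv_map_derivs //; apply: gmono => //;
      [exact: c1|exact: c2].
  by have := @entry_map_derivs_left g X 0%N (leq0n _); rewrite (cp_a0 hV) => ->.
- move=> j hj; rewrite row_deriv_map_derivs ?Xlam //.
  by rewrite /row_deriv_defined leqnn.
- move=> j hj; rewrite row_deriv_map_derivs ?Xlambar //.
  by rewrite /row_deriv_defined (cp_a0 hV).
- move=> i hi; have /andP[i1 ile] := hi.
  by rewrite !entry_map_derivs_left ?Xmu // (leq_trans (leq_pred i)).
Qed.

Lemma entry_left_int lam lambar (mu : nat -> int) X i :
  SC_boundary n a b lam lambar (fun i => (mu i)%:~R) X ->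
  (i <= n)%N -> entry X i (a i) \is a Num.int.
Proof.
move=> [[_ X00] _ _ Xmu]; elim: i => [|i IHi] ile.
  by rewrite (cp_a0 hV) X00.
rewrite -[entry X _ _](subrK (entry X i (a i))) rpredD ?IHi 1?ltnW //.
by rewrite (Xmu i.+1) // intr_int.
Qed.

End MapDerivs.

Theorem theorem2 (R : realType) (n : nat) (a b : nat -> int)
    (hV : convex_params n a b) (lam lambar : int -> int) (mu : nat -> int) :
  integral_polyhedron (SC_boundary (R := R) n a b
    (fun j => (lam j)%:~R) (fun j => (lambar j)%:~R) (fun i => (mu i)%:~R)).
Proof.
move=> F faceF [X FX].
have PX : SC_boundary (R := R) n a b (fun j => (lam j)%:~R)
    (fun j => (lambar j)%:~R) (fun i => (mu i)%:~R) X.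
  by case: faceF FX => c [d [_ ->]] [].
pose flr (t : R) : R := (Num.floor t)%:~R.
have flr_int (m : int) : flr m%:~R = m%:~R by rewrite /flr intrKfloor.
exists (map_derivs flr X); last first.
  move=> v; rewrite ffunE.
  have := valP v; rewrite [val v]surjective_pairing mem_configuration //.
  move=> /andP[ile _]; rewrite rpredD ?(entry_left_int hV PX) //.
  by apply: rpred_sum => k _; apply: intr_int.
have [e e0 e_gap] := exists_le_pos_gaps
  (fun v : configuration n a b => row_deriv X (val v).1 (val v).2).
apply: (face_prolongation faceF FX _ e0).
  apply: SC_boundary_map_derivs => // i j k l _ _ le_ij_kl.
  by rewrite ler_int le_floor.
rewrite -map_derivs_prolongation //.
apply: SC_boundary_map_derivs => // [m|i j k l ij kl].
  by rewrite flr_int subrr mulr0 addr0.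
rewrite le_eqVlt => /predU1P[->//|lt_ij_kl].
have := e_gap (Sub (i, j) (row_deriv_defined_mem hV ij))
              (Sub (k, l) (row_deriv_defined_mem hV kl)) lt_ij_kl.
rewrite /= => gap.
(* The fractional parts differ by at most 1, so their contributions differ by
   at most [e], which is at most the gap. *)
set s := row_deriv X i j in gap *; set t := row_deriv X k l in gap *.
have s1 : s - flr s <= 1.
  by rewrite lerBlDl -[1]/(1%:~R) -intrD ltW // floorD1_gt.
have t0 : 0 <= t - flr t by rewrite subr_ge0 floor_le.
have : e * (s - flr s) <= e by rewrite ger_pMr.
have : 0 <= e * (t - flr t) by rewrite mulr_ge0 // ltW.
by lra.
Qed.
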